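(* Let $p$ be an odd prime, let $a,b,c$ be nonzero elements of the prime field $\mathbb{F}_p$, and let $n\ge1$ be an integer. Let $\mathcal{C}$ be the projective non-singular curve of genus $3$ given by the equation $ax^4+by^4+cz^4=0$. Then (i) $\mathcal{C}$ is maximal over $\mathbb{F}_{p^{2n}}$ if and only if $4$ divides $p^n+1$; (ii) $\mathcal{C}$ is minimal over $\mathbb{F}_{p^{2n}}$ if and only if $4$ divides $p^n-1$ and $p\equiv 3\pmod 4$.
   Context: A projective, geometrically irreducible, non-singular algebraic curve $\mathcal{C}$ of genus $g$ defined over $\mathbb{F}_{Q^2}$ is called maximal over $\mathbb{F}_{Q^2}$ if it attains the Hasse-Weil upper bound, i.e. its number of $\mathbb{F}_{Q^2}$-rational points is $Q^2+1+2gQ$; it is called minimal over $\mathbb{F}_{Q^2}$ if it attains the Hasse-Weil lower bound, i.e. this number is $Q^2+1-2gQ$. *)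

(* Defs.v *)
From HB Require Import structures.
From mathcomp Require Import all_boot all_order all_fingroup all_algebra all_field.
From mathcomp Require Export mpoly.

Set Implicit Arguments.
Unset Strict Implicit.
Unset Printing Implicit Defensive.

Import GRing.Theory.
Local Open Scope ring_scope.

(* A projective plane curve over K is represented by a homogeneous form in    *)
(* three variables; [mpoly_at f v] is the value of f at the vector v.         *)
Definition mpoly_at (K : comNzRingType) (f : {mpoly K[3]}) (v : 'rV[K]_3) : K :=
  f.@[fun i => v 0 i].

Definition irreducible_mpoly (K : fieldType) (f : {mpoly K[3]}) : Prop :=
  [/\ f != 0, f \isn't a GRing.unit &
      forall g h : {mpoly K[3]},
        f = g * h -> g \is a GRing.unit \/ h \is a GRing.unit].

(* Here and below, "geometric" properties are tested over every algebraically *)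
(* closed extension of K.                                                     *)
Definition geom_irreducible (K : fieldType) (f : {mpoly K[3]}) : Prop :=
  forall (L : closedFieldType) (phi : {rmorphism K -> L}),
    irreducible_mpoly (map_mpoly phi f).

Definition singular_vec (L : fieldType) (f : {mpoly L[3]}) (v : 'rV[L]_3) : bool :=
  (mpoly_at f v == 0) && [forall i : 'I_3, mpoly_at f^`M(i) v == 0].

Definition nonsingular (K : fieldType) (f : {mpoly K[3]}) : Prop :=
  forall (L : closedFieldType) (phi : {rmorphism K -> L}) (v : 'rV[L]_3),
    v != 0 -> ~~ singular_vec (map_mpoly phi f) v.

(* The degree m part of the ideal (f), for f homogeneous: [indhomog] sends    *)
(* the multiples of f by a monomial that are not homogeneous of degree m to 0.*)
Definition ideal_part (K : fieldType) (f : {mpoly K[3]}) (m : nat)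
    : {vspace dhomog 3 K m} :=
  <<[seq indhomog m (f * 'X_[u]) | u : 'X_{1..3 < m.+1}]>>%VS.

(* The Hilbert function m |-> dim_K (K[x, y, z] / (f))_m.                     *)
Definition hilbert_fun (K : fieldType) (f : {mpoly K[3]}) (m : nat) : nat :=
  (\dim {: dhomog 3 K m} - \dim (ideal_part f m))%N.

Definition is_hilbert_poly (K : fieldType) (f : {mpoly K[3]}) (P : {poly rat})
    : Prop :=
  exists m0 : nat, forall m : nat, (m0 <= m)%N ->
    P.[m%:R] = (hilbert_fun f m)%:R.

(* The (arithmetic) genus 1 - P(0), P being the Hilbert polynomial. On        *)
(* nonsingular, geometrically irreducible curves, where it is used, it is     *)
(* the genus.                                                                 *)
Definition has_genus (K : fieldType) (f : {mpoly K[3]}) (g : nat) : Prop :=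
  exists2 P : {poly rat}, is_hilbert_poly f P & P.[0] = 1 - g%:R.

Definition smooth_curve_of_genus (K : fieldType) (f : {mpoly K[3]}) (g : nat)
    : Prop :=
  [/\ exists d : nat, f \is d.-homog,
      geom_irreducible f, nonsingular f & has_genus f g].

(* A point of P^2(K) is the set of nonzero multiples of a nonzero vector.     *)
Definition proj_point (K : finFieldType) (v : 'rV[K]_3) : {set 'rV[K]_3} :=
  [set k *: v | k : K & k != 0].

Definition rational_points (K : finFieldType) (f : {mpoly K[3]})
    : {set {set 'rV[K]_3}} :=
  [set proj_point v | v : 'rV[K]_3 & (v != 0) && (mpoly_at f v == 0)].

Definition maximal_curve (K : finFieldType) (f : {mpoly K[3]}) : Prop :=
  exists Q g : nat,
    [/\ #|K| = (Q ^ 2)%N, smooth_curve_of_genus f g &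
        #|rational_points f| = (Q ^ 2 + 1 + 2 * g * Q)%N].

(* #|C(K)| = Q^2 + 1 - 2gQ, stated in int since the right-hand side can be    *)
(* negative.                                                                  *)
Definition minimal_curve (K : finFieldType) (f : {mpoly K[3]}) : Prop :=
  exists Q g : nat,
    [/\ #|K| = (Q ^ 2)%N, smooth_curve_of_genus f g &
        #|rational_points f|%:Z = (Q ^ 2 + 1)%:Z - (2 * g * Q)%:Z].

Definition diag_quartic (F : comNzRingType) (a b c : F) : {mpoly F[3]} :=
  a *: 'X_0 ^+ 4 + b *: 'X_1 ^+ 4 + c *: 'X_2 ^+ 4.

(* Main.v *)
Require Import Defs.
From HB Require Import structures.
From mathcomp Require Import all_boot all_order all_fingroup all_algebra all_field.
From mathcomp Require Import all_solvable ring zify.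

Import Order.TTheory GRing.Theory Num.Theory.
Local Open Scope ring_scope.

(** Let q = p^(2n) be the cardinal of K and eta its quadratic character.  Every
    element of the prime field is a square in K, so the curve can be written
    alpha^2 x^4 + beta^2 y^4 + gamma^2 z^4 = 0, which covers the conic
    X^2 + Y^2 + Z^2 = 0 by squaring the coordinates.  Counting the points of
    the fibres with eta and parametrizing the conic gives

      N = q + 1 + (eta(alpha gamma) + eta(beta gamma) + eta(alpha beta)) S,

    where S is the Jacobsthal sum of eta(x (x^2 + 1)) over x in K
    ([card_points_squares]).  Up to a shift by q + 1, S counts the points of the
    elliptic curve y^2 = x^3 + x, and the formula reflects that the Jacobian of
    the quartic is isogenous to a product of three twists of it.

    If p = 3 mod 4, the three signs are 1, since the elements of the prime field
    are fourth powers in K.  Jacobsthal's identity S^2 + T^2 = 4q, T being the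
    sum of eta(x (x^2 + g)) for a nonresidue g, exhibits q as a sum of two
    squares.  As p is inert in the Gaussian integers, one of the two vanishes,
    and the congruence S = 6 mod 8 leaves only S = - 2 (-p)^n
    ([jacobsthal1_inert]).  Hence N = q + 1 - 6 (-p)^n: the curve is maximal for
    odd n and minimal for even n.

    If p = 1 mod 4, the sum of the three signs is 3 or -1, hence prime to p.
    Euler's criterion and the vanishing of power sums give
    S = - binomial((q-1)/2, (q-1)/4) modulo p ([jacobsthal1_modp]), and p does
    not divide this binomial coefficient because no carry occurs in base p
    ([bin_central_ndvd]).  Thus N is not 1 modulo p, whereas it would be for a
    maximal or minimal curve, whatever its genus.

    The geometric assertions hold over every field where 2 is invertible.  The
    partial derivatives vanish simultaneously only at 0.  Two nonconstant
    factors of the quartic would both vanish at some point of a line y = t z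
    with b t^4 + c = 0, because the quartic restricts to a x^4 there, and such a
    common zero would be singular ([diag_quartic_irreducible]).  Finally,
    multiplication by the equation is injective, so the Hilbert function in
    degree m is binomial(m + 2, 2) - binomial(m - 2, 2) = 4 m - 2, which yields
    genus 3 ([smooth_diag_quartic]). *)

(** * The quadratic character of a finite field *)

Section QuadraticCharacter.

Variable K : finFieldType.
Hypothesis two_neq0 : 2%:R != 0 :> K.

Local Notation q := #|K|.
Local Notation h := (#|K|.-1./2).

Lemma expf_card_pred (x : K) : x != 0 -> x ^+ q.-1 = 1.
Proof.
move=> x0; apply: (mulfI x0); rewrite mulr1 -exprS prednK ?expf_card //.
exact: ltnW (finNzRing_gt1 K).
Qed.

Lemma card_pred_gt0 : (0 < q.-1)%N.
Proof. by have := finNzRing_gt1 K; case: q => [|[]]. Qed.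

Lemma exists_prim_root : exists z : K, q.-1.-primitive_root z.
Proof.
have /hasP[z _ prim_z] : has q.-1.-primitive_root (enum [pred x : K | x != 0]).
  apply: has_prim_root; rewrite ?card_pred_gt0 //; last by rewrite -cardE (cardC1 0).
    apply/allP => y; rewrite mem_enum inE => y0.
    by rewrite unity_rootE expf_card_pred.
  exact: enum_uniq.
by exists z.
Qed.

(** In a cyclic group of order q - 1, the m-th powers form the subgroup of order
    (q - 1) / m, and this subgroup is the kernel of the power map with that
    exponent. *)
Lemma power_residue m (x : K) :
  (m %| q.-1)%N -> x != 0 -> x ^+ (q.-1 %/ m) = 1 -> exists y : K, x = y ^+ m.
Proof.
move=> m_dvd x0 xm.
have q1_gt0 := card_pred_gt0; have [z prim_z] := exists_prim_root.
have [i xE] := prim_rootP prim_z (expf_card_pred x x0).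
move: xm; rewrite xE -exprM => /eqP; rewrite -(prim_order_dvd prim_z).
have m_gt0 := dvdn_gt0 q1_gt0 m_dvd.
have k_gt0 : (0 < q.-1 %/ m)%N by rewrite divn_gt0 //; exact: dvdn_leq m_dvd.
rewrite -{1}(divnK m_dvd) [(i * _)%N]mulnC dvdn_pmul2l //.
by case/dvdnP => j ->; exists (z ^+ j); rewrite exprM.
Qed.

Lemma card_odd : q = h.*2.+1.
Proof.
have q_gt1 := finNzRing_gt1 K.
have : odd q.
  apply: contraT => even_q.
  have := expf_card (-1 : K); rewrite -signr_odd (negPf even_q) expr0.
  by move/eqP; rewrite -subr_eq0 opprK (negPf two_neq0).
by case: q q_gt1 => [|k] //= _ even_k; rewrite even_halfK.
Qed.

Lemma half_card_gt0 : (0 < h)%N.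
Proof. by move: card_odd (finNzRing_gt1 K); case: h => // ->. Qed.

Lemma one_neqN1 : (1 == -1 :> K) = false.
Proof. by rewrite -subr_eq0 opprK; apply: negPf. Qed.

(** Euler's criterion is taken as the definition: multiplicativity and the value
    modulo p are immediate, and [card_sqrt] recovers the link with squares. *)
Definition qchar (x : K) : int :=
  if x == 0 then 0 else if x ^+ h == 1 then 1 else -1.

Lemma qchar_expr (x : K) : (qchar x)%:~R = x ^+ h.
Proof.
rewrite /qchar; case: eqVneq => [->|x0].
  by rewrite expr0n; case: h half_card_gt0.
case: eqP => [->|xh_neq1] //; rewrite mulrN1z.
have : (x ^+ h) ^+ 2 == 1.
  by rewrite -exprM muln2 -(expf_card_pred x x0) {2}card_odd.
by rewrite sqrf_eq1 => /orP[/eqP|/eqP->].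
Qed.

(** Since 2 is invertible, -1, 0 and 1 stay distinct in K, so identities between
    values of the character can be checked in K. *)
Lemma small_intr_inj (m n : int) : `|m| <= 1 -> `|n| <= 1 -> m%:~R = n%:~R :> K -> m = n.
Proof.
have o := one_neqN1; have o' := oner_eq0 K.
have N0 : (-1 == 0 :> K) = false by rewrite oppr_eq0.
case: m => [[|[|m]]|[|m]] //; case: n => [[|[|n]]|[|n]] // _ _ /eqP.
- by rewrite eq_sym oner_eq0.
- by rewrite eq_sym N0.
- by rewrite o'.
- by rewrite o.
- by rewrite N0.
- by rewrite eq_sym o.
Qed.

Lemma qchar_norm x : `|qchar x| <= 1.
Proof. by rewrite /qchar; case: ifP => // _; case: ifP. Qed.

Lemma qcharM x y : qchar (x * y) = qchar x * qchar y.
Proof.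
apply: small_intr_inj; first exact: qchar_norm.
  by rewrite normrM -[1]mulr1 ler_pM ?qchar_norm.
by rewrite intrM !qchar_expr exprMn.
Qed.

Lemma qchar0 : qchar 0 = 0. Proof. by rewrite /qchar eqxx. Qed.

Lemma qchar1 : qchar 1 = 1. Proof. by rewrite /qchar oner_eq0 expr1n eqxx. Qed.

Lemma qchar_sqr x : x != 0 -> qchar x ^+ 2 = 1.
Proof. by rewrite /qchar => /negPf->; case: ifP. Qed.

Lemma qcharX2 x : x != 0 -> qchar (x ^+ 2) = 1.
Proof. by move=> x0; rewrite expr2 qcharM -expr2 qchar_sqr. Qed.

Lemma qchar_eq0 x : (qchar x == 0) = (x == 0).
Proof. by rewrite /qchar; case: ifP => //; case: ifP. Qed.

Lemma qchar_pm1 x : x != 0 -> qchar x = 1 \/ qchar x = -1.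
Proof. by rewrite /qchar => /negPf->; case: ifP; [left | right]. Qed.

Lemma qcharV x : qchar x^-1 = qchar x.
Proof.
have [->|x0] := eqVneq x 0; first by rewrite invr0.
by rewrite -[qchar x^-1]mulr1 -(qchar_sqr _ x0) expr2 mulrA -qcharM mulVf // qchar1 mul1r.
Qed.

Lemma card_sqrt x : \sum_(y : K | y ^+ 2 == x) 1 = 1 + qchar x :> int.
Proof.
have [->|x0] := eqVneq x 0.
  by rewrite qchar0 addr0 (big_pred1 0) // => y; rewrite expf_eq0.
have [x1|xN1] := qchar_pm1 _ x0; last first.
  rewrite xN1 addrN big_pred0 // => y; apply/negP => /eqP yx.
  have y0 : y != 0 by apply: contra_neq x0 => y0; rewrite -yx y0 expr0n.
  by move: xN1; rewrite -yx qcharX2.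
have [y yx] : exists y, x = y ^+ 2.
  apply: power_residue => //; first by rewrite {1}card_odd /= dvdn2 odd_double.
  by rewrite divn2 -qchar_expr x1.
have y0 : y != 0 by apply: contra_neq x0 => y0; rewrite yx y0 expr0n.
rewrite x1 (bigD1 y) ?yx //= (bigD1 (- y)) /=; last first.
  by rewrite sqrrN eqxx eq_sym -addr_eq0 -mulr2n -mulr_natl mulf_neq0.
rewrite big_pred0 // => z; rewrite eqf_sqr.
by case: eqP => //= _; case: eqP.
Qed.

(** Substituting a square for the variable of a sum costs the weight 1 + eta;
    all fibre counts below come from this. *)
Lemma sum_sqr (F : K -> int) d : d != 0 ->
  \sum_(y : K) F (y ^+ 2 / d) = \sum_(s : K) (1 + qchar (d * s)) * F s.
Proof.
move=> d0; rewrite (partition_big (fun y => y ^+ 2 / d) predT) //=.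
apply: eq_bigr => s _; rewrite -card_sqrt mulr_suml; apply: eq_big => [y|y /eqP->].
  by rewrite [d * s]mulrC; apply/eqP/eqP => [<-|->]; rewrite ?mulfK ?divfK.
by rewrite mul1r.
Qed.

Lemma sum_qchar : \sum_(x : K) qchar x = 0.
Proof.
have := sum_sqr (fun _ => 1) 1 (oner_neq0 K).
under [RHS]eq_bigr do rewrite mul1r mulr1.
by rewrite big_split /= -[LHS]addr0 => /addrI/esym.
Qed.

Lemma sum_shift (F : K -> int) c : \sum_x F (x + c) = \sum_x F x.
Proof. by rewrite [RHS](reindex_inj (addIr c)). Qed.

Lemma sum_scale (F : K -> int) c : c != 0 -> \sum_x F (c * x) = \sum_x F x.
Proof. by move=> c0; rewrite [RHS](reindex_inj (mulfI c0)). Qed.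

(** For A <> B, move A to 0 and divide the product by x^2: this turns the sum into
    that of eta(1 + t) over t <> 0, that is - eta(1). *)
Lemma sum_qchar_pair A B :
  \sum_x qchar ((x + A) * (x + B)) = (if A == B then q%:R else 0) - 1.
Proof.
have -> : \sum_x qchar ((x + A) * (x + B)) = \sum_x qchar (x * (x + (B - A))).
  by rewrite -[RHS](sum_shift _ A); apply: eq_bigr => x _; congr (qchar (_ * _)); ring.
case: eqVneq => [->|neAB].
  rewrite subrr (bigD1 0) //= mul0r qchar0 add0r.
  rewrite (eq_bigr (fun=> 1)) => [|x x0]; last by rewrite addr0 -expr2 qcharX2.
  by rewrite sumr_const (cardC1 0) -(natrB _ (ltnW (finNzRing_gt1 K))) subn1.
have D0 : B - A != 0 by rewrite subr_eq0 eq_sym.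
set D := B - A in D0 *; rewrite (bigD1 0) //= mul0r qchar0 !add0r.
have -> : \sum_(x | x != 0) qchar (x * (x + D)) = \sum_(t | t != 0) qchar (1 + t).
  rewrite [RHS](reindex_onto (fun x => D / x) (fun x => D / x)) => [|x x0]; last first.
    by field; rewrite x0.
  apply: eq_big => [x|x x0].
    have [->|x0] := eqVneq x 0; first by rewrite invr0 mulr0 eqxx.
    by rewrite mulf_neq0 ?invr_eq0 //= invfM invrK mulrA mulfV // mul1r eqxx.
  rewrite (_ : x * (x + D) = x ^+ 2 * (1 + D / x)); last by field.
  by rewrite qcharM qcharX2 ?mul1r.
have := sum_qchar; rewrite -(sum_shift _ 1) (bigD1 0) //= add0r qchar1.
under eq_bigr do rewrite addrC.
by move/eqP; rewrite addrC addr_eq0 => /eqP.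
Qed.

Lemma nonresidue_exists : exists2 g : K, g != 0 & qchar g = -1.
Proof.
case: (pickP [pred g : K | qchar g == -1]) => [g /eqP g1|no_g].
  by exists g => //; rewrite -qchar_eq0 g1.
have := sum_qchar; rewrite (bigD1 0) //= qchar0 add0r (eq_bigr (fun=> 1)) => [|x x0].
  rewrite sumr_const (cardC1 0) => /eqP; rewrite pnatr_eq0.
  by have := finNzRing_gt1 K; case: #|K| => [|[]].
by have [//|xN1] := qchar_pm1 _ x0; have := no_g x; rewrite /= xN1 eqxx.
Qed.

(** * Jacobsthal sums *)

(** A primitive eighth root of unity exists exactly when q = 1 mod 8; its square
    is a square root of -1. *)
Variable zeta : K.
Hypothesis zeta4 : zeta ^+ 4 = -1.
Local Notation im := (zeta ^+ 2).

Lemma im_sqr : im ^+ 2 = -1. Proof. by rewrite -exprM. Qed.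

Lemma zeta_neq0 : zeta != 0.
Proof.
by apply: contra_eq_neq zeta4 => ->; rewrite expr0n /= eq_sym oppr_eq0 oner_eq0.
Qed.

Lemma qchar_im : qchar im = 1. Proof. exact: qcharX2 zeta_neq0. Qed.

Lemma qchar_N1 : qchar (-1) = 1.
Proof. by rewrite -im_sqr qcharX2 // expf_neq0 // zeta_neq0. Qed.

Lemma qcharN x : qchar (- x) = qchar x.
Proof. by rewrite -mulN1r qcharM qchar_N1 mul1r. Qed.

(** Because (1 + i)^2 = 2i and i is a square. *)
Lemma qchar_2 : qchar 2%:R = 1.
Proof.
have e : (1 + im) ^+ 2 = 2%:R * im by ring: im_sqr.
have i1 : 1 + im != 0.
  apply: contra_neq two_neq0 => i1; move/eqP: e; rewrite i1 expr0n eq_sym mulf_eq0.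
  by rewrite !expf_eq0 /= (negPf zeta_neq0) orbF => /eqP.
by have := qcharX2 _ i1; rewrite e qcharM qchar_im mulr1.
Qed.

(** For k <> 0, the elliptic curve y^2 = x^3 + k x has q + 1 + jacobsthal k
    points. *)
Definition jacobsthal (k : K) : int := \sum_x qchar (x * (x ^+ 2 + k)).
Local Notation S := jacobsthal.

Lemma jacobsthal_scale t k : t != 0 -> S (k * t ^+ 2) = qchar t * S k.
Proof.
move=> t0; rewrite /S -(sum_scale _ t t0) mulr_sumr; apply: eq_bigr => x _.
rewrite -qcharM (_ : t * x * _ = t ^+ 2 * (t * (x * (x ^+ 2 + k)))); last by ring.
by rewrite qcharM qcharX2 // mul1r.
Qed.

Lemma jacobsthalN1 : S (-1) = S 1.
Proof.
by rewrite -im_sqr -[im ^+ 2]mul1r jacobsthal_scale ?expf_neq0 ?zeta_neq0 // qchar_im mul1r.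
Qed.

Lemma jacobsthal0 : S 0 = 0.
Proof.
rewrite -[RHS]sum_qchar; apply: eq_bigr => x _; rewrite addr0 qcharM.
have [->|x0] := eqVneq x 0; first by rewrite qchar0 mul0r.
by rewrite qcharX2 // mulr1.
Qed.

(** Expanding the squares and summing over k first, [sum_qchar_pair] leaves only
    the pairs with y = x or y = - x, for which eta(x y) = 1. *)
Lemma sum_jacobsthal_sqr : \sum_k S k ^+ 2 = 2%:R * q%:R * (q%:R - 1) :> int.
Proof.
have -> : \sum_k S k ^+ 2 =
    \sum_x \sum_y qchar (x * y) * \sum_k qchar ((k + x ^+ 2) * (k + y ^+ 2)).
  under eq_bigr do rewrite expr2 /S big_distrlr /=.
  rewrite exchange_big; apply: eq_bigr => x _ /=; rewrite exchange_big.
  apply: eq_bigr => y _ /=; rewrite mulr_sumr; apply: eq_bigr => k _.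
  by rewrite -!qcharM; congr qchar; ring.
under eq_bigr => x _ do under eq_bigr => y _ do rewrite sum_qchar_pair mulrBr mulr1.
under eq_bigr do rewrite sumrB.
rewrite sumrB [X in _ - X](_ : _ = 0) ?subr0; last first.
  rewrite big1 // => x _; under eq_bigr do rewrite qcharM.
  by rewrite -mulr_sumr sum_qchar mulr0.
rewrite (bigD1 0) //= big1 ?add0r => [|y _]; last by rewrite mul0r qchar0 mul0r.
rewrite (eq_bigr (fun=> 2%:R * q%:R)) => [|x x0]; last first.
  rewrite -(_ : \sum_(y | y ^+ 2 == x ^+ 2) 1 = 2%:R); last by rewrite card_sqrt qcharX2.
  rewrite mulr_suml [RHS]big_mkcond; apply: eq_bigr => y _; rewrite eq_sym.
  case: eqP => [/eqP|_]; last by rewrite mulr0.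
  by rewrite eqf_sqr => /orP[]/eqP->; rewrite ?mulrN ?qcharN -expr2 qcharX2.
rewrite sumr_const (cardC1 0) -[in RHS](natrB _ (ltnW (finNzRing_gt1 K))) subn1.
by rewrite -[LHS]mulr_natr.
Qed.

(** Jacobsthal's identity: by [jacobsthal_scale] the square of [jacobsthal k]
    depends only on the square class of k, so the second moment
    [sum_jacobsthal_sqr] only involves the classes of 1 and g. *)
Lemma jacobsthal_sum_squares (g : K) : g != 0 -> qchar g = -1 ->
  S 1 ^+ 2 + S g ^+ 2 = 4%:R * q%:R.
Proof.
move=> g0 gN1.
have class_sum d : d != 0 -> (q%:R - 1) * S d ^+ 2 =
    \sum_k (1 + qchar (d^-1 * k)) * S k ^+ 2.
  move=> d0; rewrite -(sum_sqr (fun k => S k ^+ 2)) ?invr_eq0 // invrK.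
  rewrite (bigD1 0) //= expr0n mul0r jacobsthal0 expr0n add0r.
  rewrite (eq_bigr (fun=> S d ^+ 2)) => [|t t0]; last first.
    by rewrite mulrC jacobsthal_scale // exprMn qchar_sqr // mul1r.
  rewrite sumr_const (cardC1 0) -(natrB _ (ltnW (finNzRing_gt1 K))) subn1.
  by rewrite mulr_natl.
have q1 : q%:R - 1 != 0 :> int.
  by rewrite subr_eq0 pnatr_eq1 neq_ltn finNzRing_gt1 orbT.
apply: (mulfI q1); rewrite mulrDr !class_sum ?oner_eq0 // -big_split /=.
rewrite (eq_bigr (fun k => 2%:R * S k ^+ 2)) => [|k _].
  by rewrite -mulr_sumr sum_jacobsthal_sqr; ring.
by rewrite !qcharM !qcharV qchar1 gN1; ring.
Qed.

(** * Points of affine diagonal quartics *)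

(** The conic s^2 + t^2 = 1 is the hyperbola (s + i t) (s - i t) = 1,
    parametrized by w = s + i t. *)
Lemma sum_conic (F : K -> K -> int) :
  \sum_(p : K * K | p.1 ^+ 2 + p.2 ^+ 2 == 1) F p.1 p.2 =
  \sum_(w | w != 0) F ((w + w^-1) / 2%:R) ((w - w^-1) / (2%:R * im)).
Proof.
have i0 : im != 0 by rewrite expf_neq0 ?zeta_neq0.
rewrite (reindex_onto (fun w => ((w + w^-1) / 2%:R, (w - w^-1) / (2%:R * im)))
                      (fun p : K * K => p.1 + im * p.2)); last first.
  move=> [s t] /= /eqP st1; apply/eqP.
  have inv_w : (s + im * t)^-1 = s - im * t.
    by apply: mulr1_eq; rewrite -st1; ring: im_sqr.
  rewrite inv_w; apply/eqP; congr (_, _); field; rewrite ?two_neq0 ?zeta_neq0 //.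
apply: eq_bigl => w /=; have [->|w0] := eqVneq w 0.
  by rewrite invr0 subr0 addr0 !mul0r expr0n addr0 eq_sym oner_eq0.
apply/andP; split; apply/eqP; last by field; rewrite ?two_neq0 ?zeta_neq0 ?w0.
rewrite !expr_div_n exprMn im_sqr; field.
have four_neq0 : 4%:R != 0 :> K by rewrite (natrM _ 2 2) mulf_neq0.
by rewrite oppr_eq0 four_neq0 w0.
Qed.

(** The curve covers the conic s^2 + t^2 = 1 by s = x^2 / d and t = y^2 / e, so the
    fibre of (s, t) has (1 + eta(d s)) (1 + eta(e t)) points.  Along the
    parametrization by w, and up to squares, s, t and s t become w (w^2 + 1),
    w (w^2 - 1) and w^4 - 1. *)
Lemma card_quartic (d e : K) : d != 0 -> e != 0 ->
  \sum_x \sum_y ((x ^+ 2 / d) ^+ 2 + (y ^+ 2 / e) ^+ 2 == 1)%:R =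
  q%:R - 1 + (qchar d + qchar e) * S 1 + qchar (d * e) * (S 1 - 2%:R).
Proof.
move=> d0 e0.
rewrite (sum_sqr (fun s => \sum_y (s ^+ 2 + (y ^+ 2 / e) ^+ 2 == 1)%:R) _ d0).
under eq_bigr => s _ do
  rewrite (sum_sqr (fun t => (s ^+ 2 + t ^+ 2 == 1)%:R) _ e0) mulr_sumr.
rewrite pair_big /=.
transitivity (\sum_(p : K * K | p.1 ^+ 2 + p.2 ^+ 2 == 1)
    (1 + qchar (d * p.1)) * (1 + qchar (e * p.2))).
  rewrite [RHS]big_mkcond; apply: eq_bigr => p _.
  by case: eqP; rewrite ?mulr1 ?mulr0.
rewrite (sum_conic (fun s t => (1 + qchar (d * s)) * (1 + qchar (e * t)))).
rewrite (eq_bigr (fun w => 1 + qchar d * qchar (w * (w ^+ 2 + 1))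
   + qchar e * qchar (w * (w ^+ 2 + -1)) + qchar (d * e) * qchar (w ^+ 4 - 1)));
  last first.
  move=> w w0; rewrite !qcharM !qcharV qchar_2 qcharM qchar_2 qchar_im.
  have -> : qchar (w + w^-1) = qchar w * qchar (w ^+ 2 + 1).
    rewrite -(qcharV w) -qcharM; congr qchar; field; exact: w0.
  have -> : qchar (w - w^-1) = qchar w * qchar (w ^+ 2 + -1).
    rewrite -(qcharV w) -qcharM; congr qchar; field; exact: w0.
  have -> : qchar (w ^+ 4 - 1) = qchar w ^+ 2 * qchar (w ^+ 2 + 1) * qchar (w ^+ 2 + -1).
    by rewrite qchar_sqr // mul1r -qcharM; congr qchar; ring.
  by ring.
have sum1 : \sum_(w : K | w != 0) (1 : int) = q%:R - 1.
  by rewrite sumr_const (cardC1 0) -(natrB _ (ltnW (finNzRing_gt1 K))) subn1.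
have sumS k : \sum_(w | w != 0) qchar (w * (w ^+ 2 + k)) = S k.
  by rewrite /S [RHS](bigD1 0) //= mul0r qchar0 add0r.
have sum4 : \sum_(w | w != 0) qchar (w ^+ 4 - 1) = S 1 - 2%:R.
  have := sum_sqr (fun v => qchar (v ^+ 2 - 1)) 1 (oner_neq0 K).
  rewrite (bigD1 0) //= expr0n mul0r expr0n add0r qchar_N1.
  under eq_bigr do rewrite divr1 -exprM.
  under [X in _ = X -> _]eq_bigr => v _.
    rewrite mul1r mulrDl mul1r -qcharM.
    have -> : v ^+ 2 - 1 = (v + 1) * (v + -1) by ring.
    over.
  rewrite big_split /= sum_qchar_pair one_neqN1.
  rewrite [X in _ = _ + X](_ : _ = S 1); last first.
    by rewrite -jacobsthalN1; apply: eq_bigr => v _; congr qchar; ring.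
  by move=> e4; apply: (addrI 1); rewrite e4; ring.
by rewrite !big_split /= -!mulr_sumr sum1 !sumS sum4 jacobsthalN1; ring.
Qed.

(** The square roots of u are s and - s, which have the same character. *)
Lemma sum_root4 (u s : K) : u != 0 -> u = s ^+ 2 ->
  \sum_(x | x ^+ 4 == u) 1 = 2%:R * (1 + qchar s) :> int.
Proof.
move=> u0 us.
rewrite (partition_big (fun x => x ^+ 2) (fun t => t ^+ 2 == u)) /= => [|x]; last first.
  by rewrite -exprM.
have s0 : s != 0 by apply: contra_neq u0 => s0; rewrite us s0 expr0n.
transitivity (\sum_(t | t ^+ 2 == u) (1 + qchar s)).
  apply: eq_bigr => t tu; have ->: qchar s = qchar t.
    by move: tu; rewrite us eqf_sqr => /orP[]/eqP->; rewrite ?qcharN.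
  rewrite -card_sqrt; apply: eq_bigl => x; apply: andb_idl => /eqP xt.
  by rewrite -(eqP tu) -xt -exprM.
have -> : 2%:R = \sum_(t | t ^+ 2 == u) 1 :> int by rewrite card_sqrt us qcharX2.
by rewrite mulr_suml; apply: eq_bigr => t _; rewrite mul1r.
Qed.

Lemma sum_root4_cases (u : K) : u != 0 ->
  \sum_(x | x ^+ 4 == u) 1 = 0%:Z \/ \sum_(x | x ^+ 4 == u) 1 = 4 :> int.
Proof.
move=> u0; case: (pickP [pred s | s ^+ 2 == u]) => [s /eqP us|no_s].
  have s0 : s != 0 by apply: contra_neq u0 => s0; rewrite -us s0 expr0n.
  rewrite (sum_root4 u s) //; have [->|->] := qchar_pm1 s s0; [by right | by left].
left; rewrite big_pred0 // => x; apply/negP => /eqP xu.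
by have := no_s (x ^+ 2); rewrite /= -exprM xu eqxx.
Qed.

(** Count the solutions of x^4 + y^4 = 1 in two ways: [card_quartic] gives
    q - 3 + 3 S, whereas they come in packets of 16 apart from the eight with
    x y = 0.  As q = 1 mod 8, this determines S modulo 8. *)
Lemma jacobsthal1_mod8 : (8 %| q.-1)%N -> exists k : int, S 1 = 8%:R * k - 2%:R.
Proof.
move=> q8.
pose r (u : K) : int := \sum_(x | x ^+ 4 == u) 1.
have := card_quartic 1 1 (oner_neq0 K) (oner_neq0 K).
rewrite mulr1 qchar1.
have -> : \sum_(x : K) \sum_(y : K) ((x ^+ 2 / 1) ^+ 2 + (y ^+ 2 / 1) ^+ 2 == 1)%:R =
    \sum_u r u * r (1 - u) :> int.
  rewrite [LHS](partition_big (fun x => x ^+ 4) predT) //=; apply: eq_bigr => u _.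
  rewrite {1}/r mulr_suml; apply: eq_bigr => x /eqP xu; rewrite mul1r [RHS]big_mkcond.
  apply: eq_bigr => y _; rewrite !divr1 -!exprM xu.
  have -> : (u + y ^+ 4 == 1) = (y ^+ 4 == 1 - u); last by case: eqP.
  by apply/eqP/eqP => [<-|->]; ring.
have r0 : r 0 = 1.
  by rewrite /r (big_pred1 0) // => x; rewrite expf_eq0.
have r1 : r 1 = 4.
  by rewrite /r (sum_root4 1 1) ?oner_neq0 ?expr1n // qchar1.
rewrite (bigD1 0) //= (bigD1 1) /= ?oner_neq0 // subr0 subrr r0 r1.
have [k ->] : exists k : int, \sum_(u | (u != 0) && (u != 1)) r u * r (1 - u) = 16 * k.
  exists (\sum_(u | (u != 0) && (u != 1)) ((r u == 4) && (r (1 - u) == 4))%:R).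
  rewrite mulr_sumr; apply: eq_bigr => u /andP[u0 u1].
  have v0 : 1 - u != 0 by rewrite subr_eq0 eq_sym.
  by case: (sum_root4_cases u u0); case: (sum_root4_cases (1 - u) v0); rewrite /r => -> ->.
have [m qE] : exists m : nat, q = (8 * m).+1.
  case/dvdnP: q8 => m q8; exists m.
  by rewrite -(prednK (ltnW (finNzRing_gt1 K))) q8 mulnC.
move: (S 1) => s e; exists (6 * k - 3 * m%:R - s + 4).
by move: e; rewrite qE; lia.
Qed.

(** * The Jacobsthal sum modulo the characteristic *)

Lemma card_eq0 : q%:R = 0 :> K.
Proof.
have /= := @expg_cardG K [group of [set: K]] 1%R (in_setT _).
by rewrite cardsT FinRing.zmodXgE => ->.
Qed.

(** If q - 1 does not divide k, some z has z^k <> 1, and the substitution of z x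
    for x multiplies the sum by z^k. *)
Lemma sum_expr k : (0 < k)%N ->
  \sum_(x : K) x ^+ k = if (q.-1 %| k)%N then -1 else 0.
Proof.
move=> k_gt0; case: ifP => [/dvdnP[j kE]|kN].
  rewrite (bigD1 0) //= expr0n (gtn_eqF k_gt0) add0r (eq_bigr (fun=> 1)) => [|x x0].
    rewrite sumr_const (cardC1 0); apply: (addrI 1).
    rewrite -[X in X + _]/(1%:R) -natrD add1n.
    by rewrite (prednK (ltnW (finNzRing_gt1 K))) card_eq0 subrr.
  by rewrite kE mulnC exprM expf_card_pred // expr1n.
have [z prim_z] := exists_prim_root.
have z0 : z != 0.
  apply: contra_eq_neq (prim_expr_order prim_z) => ->.
  by rewrite expr0n (gtn_eqF card_pred_gt0) eq_sym oner_eq0.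
have zk1 : z ^+ k - 1 != 0 by rewrite subr_eq0 -(prim_order_dvd prim_z) kN.
apply: (mulfI zk1); rewrite mulr0 mulrBl mul1r; apply/eqP; rewrite subr_eq0; apply/eqP.
rewrite [RHS](reindex_inj (mulfI z0)) mulr_sumr.
by apply: eq_bigr => x _; rewrite exprMn.
Qed.

(** By Euler's criterion S is the sum of the (x (x^2 + 1))^h, and among the
    exponents h, h + 2, ..., 3 h only 2 h = q - 1 contributes to the power sums. *)
Lemma jacobsthal1_modp m : h = m.*2 -> (S 1)%:~R = - 'C(h, m)%:R :> K.
Proof.
move=> hE; have h0 := half_card_gt0.
have only_middle H Q j c : H = m.*2 -> (0 < H)%N -> Q = H.*2 -> (j < H.+1)%N ->
    (H + 2 * (H - j) = c * Q)%N -> j = m.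
  move=> -> m_gt0 -> lt_j; case: c => [|[|c]]; rewrite ?mulSn; nia.
have qE : q.-1 = h.*2 by rewrite {1}card_odd.
have -> : (S 1)%:~R = \sum_(j < h.+1) 'C(h, j)%:R * \sum_(x : K) x ^+ (h + 2 * (h - j)).
  rewrite /S (big_morph _ (fun a b : int => rmorphD (intmul 1) a b) (rmorph0 (intmul 1))).
  under eq_bigr => x _ do rewrite /= qchar_expr exprMn exprDn mulr_sumr.
  rewrite exchange_big /=; apply: eq_bigr => j _; rewrite mulr_sumr; apply: eq_bigr => x _.
  by rewrite expr1n mulr1 -exprM mulrnAr -exprD mulr_natl.
have m_lt : (m < h.+1)%N by rewrite hE ltnS -addnn leq_addl.
rewrite (bigD1 (Ordinal m_lt)) //= [X in _ + X]big1 => [|j ne_jm];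
  rewrite sum_expr ?addn_gt0 ?h0 //.
  have -> : (h + 2 * (h - m) = q.-1)%N by rewrite qE; lia.
  by rewrite dvdnn addr0 mulrN mulr1.
case: ifP; rewrite ?mulr0 // => /dvdnP[c cE]; case/eqP: ne_jm; apply: val_inj => /=.
exact: only_middle hE h0 qE (ltn_ord j) cE.
Qed.
End QuadraticCharacter.

(** In base p the digits of m are all (p - 1) / 4, so adding m to itself
    produces no carry; in Legendre's formula every quotient of 2 m is twice that
    of m. *)
Lemma bin_central_ndvd p n m : prime p -> (p %% 4 = 1)%N -> (p ^ n = 4 * m + 1)%N ->
  ~~ (p %| 'C(m.*2, m))%N.
Proof.
move=> p_pr p1 pn.
have C_gt0 : (0 < 'C(m.*2, m))%N by rewrite bin_gt0 -addnn leq_addl.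
suff: logn p 'C(m.*2, m) = 0%N.
  by apply: contra_eqN => dvd; rewrite -lt0n logn_gt0 mem_primes p_pr C_gt0.
have m_le : (m <= m.*2)%N by rewrite -addnn leq_addl.
have : (logn p (m.*2)`! = logn p 'C(m.*2, m) + (logn p m`! + logn p m`!))%N.
  have -> : (m.*2)`! = ('C(m.*2, m) * (m`! * m`!))%N.
    by rewrite -(bin_fact m_le); congr (_ * (_ * _`!))%N; rewrite -addnn addnK.
  by rewrite !lognM ?muln_gt0 ?fact_gt0 ?C_gt0.
suff -> : (logn p (m.*2)`! = logn p m`! + logn p m`!)%N by lia.
have pow1 k : exists a, (p ^ k = 4 * a + 1)%N.
  exists (p ^ k %/ 4)%N; rewrite {1}(divn_eq (p ^ k) 4) -modnXm p1 exp1n; lia.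
have digit k : (m.*2 %/ p ^ k = (m %/ p ^ k).*2)%N.
  have pk_gt0 : (0 < p ^ k)%N by rewrite expn_gt0 prime_gt0.
  have [le_kn|lt_nk] := leqP k n.
    have [a aE] := pow1 (n - k)%N; have [b bE] := pow1 k.
    have mE : m = (a * p ^ k + b)%N.
      by move: pn; rewrite -(subnK le_kn) expnD aE bE; nia.
    have -> : m.*2 = (a.*2 * p ^ k + b.*2)%N by rewrite mE; lia.
    by rewrite mE !divnMDl // !divn_small; lia.
  have : (p ^ n < p ^ k)%N by rewrite ltn_exp2l ?prime_gt1.
  by move=> lt_pn_pk; rewrite !divn_small; lia.
rewrite !logn_fact // (eq_bigr (fun k => (m %/ p ^ k).*2)) => [|k _]; last exact: digit.
rewrite (@big_cat_nat _ _ _ m.+1) //= [X in (_ + X)%N]big_nat_cond.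
rewrite [X in (_ + X)%N]big1 => [|k /andP[/andP[lt_mk _] _]]; last first.
  by rewrite divn_small // (leq_trans lt_mk) // ltnW // ltn_expl // prime_gt1.
by rewrite addn0 -big_split /=; apply: eq_bigr => k _; rewrite addnn.
Qed.

(** * The Jacobsthal sum when p = 3 mod 4 *)

(** Otherwise A / B would be a square root of -1 modulo p, contradicting Fermat's
    little theorem because (p - 1) / 2 is odd. *)
Lemma dvd_sum_squares p (A B : int) : prime p -> (p %% 4 = 3)%N ->
  (p%:Z %| A ^+ 2 + B ^+ 2)%Z -> (p%:Z %| A)%Z && (p%:Z %| B)%Z.
Proof.
move=> p_pr p3.
have chFp := pchar_Fp p_pr.
rewrite !(dvdz_pcharf chFp) rmorphD !rmorphXn /=.
set a := A%:~R; set b := B%:~R => /eqP ab.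
have [b0|b0] := eqVneq b 0.
  by move/eqP: ab; rewrite b0 expr0n addr0 expf_eq0 /= => ->.
have t2 : (a / b) ^+ 2 = -1.
  by rewrite expr_div_n (canRL (addrK _) ab) sub0r mulNr mulfV // expf_neq0.
have t0 : a / b != 0.
  by apply: contra_eq_neq t2 => ->; rewrite expr0n eq_sym oppr_eq0 oner_eq0.
have := expf_card_pred _ _ t0; rewrite card_Fp //.
have -> : p.-1 = (2 * (p %/ 4).*2.+1)%N by rewrite {1}(divn_eq p 4) p3; lia.
rewrite exprM t2 -signr_odd /= odd_double expr1 => /esym/eqP.
rewrite -subr_eq0 opprK -(natrD _ 1 1) -(dvdn_pcharf chFp) => /dvdn_leq; lia.
Qed.

(** Descent: p divides both terms, so dividing by p^2 reduces to A^2 + B^2 = 1. *)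
Lemma sum_squares_pow p n (A B : int) : prime p -> (p %% 4 = 3)%N ->
  A ^+ 2 + B ^+ 2 = (p ^ (2 * n))%:Z -> A = 0 \/ B = 0.
Proof.
move=> p_pr p3; elim: n A B => [|n IHn] A B.
  by rewrite muln0 expn0 => AB; nia.
move=> AB; have : (p%:Z %| A ^+ 2 + B ^+ 2)%Z.
  by rewrite AB dvdzE /= dvdn_exp.
case/(dvd_sum_squares _ _ _ p_pr p3)/andP => /dvdzP[A' AE] /dvdzP[B' BE].
have pp_neq0 : (p ^ 2)%:Z != 0 by rewrite eqz_nat expn_eq0 andbT gtn_eqF ?prime_gt0.
case: (IHn A' B') => [|A0|B0].
- apply: (mulfI pp_neq0); rewrite -PoszM -expnD -[(2 + 2 * n)%N]mulnS -AB AE BE.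
  by rewrite -mulnn PoszM; ring.
- by left; rewrite AE A0 mul0r.
- by right; rewrite BE B0 mul0r.
Qed.

(** Here S / 2 = 3 mod 4 is odd, hence it is the term that survives in
    S^2 + T^2 = 4q; the same congruence selects the sign. *)
Lemma jacobsthal1_inert (K : finFieldType) (zeta : K) p n :
  2%:R != 0 :> K -> zeta ^+ 4 = -1 -> (8 %| #|K|.-1)%N ->
  prime p -> (p %% 4 = 3)%N -> #|K| = (p ^ (2 * n))%N ->
  jacobsthal K 1 =
  if (p ^ n %% 4 == 3)%N then 2%:R * (p ^ n)%:R else - (2%:R * (p ^ n)%:R).
Proof.
move=> two_neq0 zeta4 q8 p_pr p3 qE.
have [g g0 gN1] := nonresidue_exists K two_neq0.
have := jacobsthal_sum_squares K two_neq0 zeta zeta4 g g0 gN1.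
have [k ->] := jacobsthal1_mod8 K two_neq0 zeta zeta4 q8.
rewrite qE; move: (jacobsthal K g) => B.
have -> : (p ^ (2 * n))%:R = (p ^ n)%:R ^+ 2 :> int by rewrite mulnC expnM natrX.
set Q := (p ^ n)%N => eqB.
have [B' BE] : exists B', B = 2%:R * B'.
  suff : (2 %| B)%Z by case/dvdzP => B' ->; exists B'; rewrite mulrC.
  have : (2 %| B ^+ 2)%Z.
    apply/dvdzP; exists (2 * Q%:R ^+ 2 - 2%:R * (4%:R * k - 1) ^+ 2); move: eqB; lia.
  by rewrite !dvdzE abszX Euclid_dvdX // andbT.
have AB : (4%:R * k - 1) ^+ 2 + B' ^+ 2 = Q%:R ^+ 2.
  have four0 : 4%:R != 0 :> int by [].
  by apply: (mulfI four0); rewrite -eqB BE; ring.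
have Q_mod : (Q %% 4 = 1 \/ Q %% 4 = 3)%N.
  rewrite /Q -modnXm p3 -(odd_double_half n) expnD -mul2n expnM.
  by rewrite -modnMmr -modnXm exp1n muln1; case: (odd n); [right | left].
have AB' : (4%:R * k - 1) ^+ 2 + B' ^+ 2 = (p ^ (2 * n))%:Z.
  by rewrite AB mulnC expnM -natrX natz.
have [A0|B0] := sum_squares_pow p n _ _ p_pr p3 AB'.
  by move: A0; clear; lia.
have : (4%:R * k - 1) ^+ 2 == Q%:R ^+ 2 :> int by rewrite -AB B0 expr0n addr0.
rewrite eqf_sqr => /orP[]/eqP kQ; case: Q_mod => Q4; rewrite Q4 /=;
  by move: kQ Q4; clear; lia.
Qed.

(** * Nonsingularity and irreducibility *)

Section Geometry.

Variables (L : fieldType) (a b c : L).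
Local Notation f := (diag_quartic a b c).

Definition vec3 (x y z : L) : 'rV[L]_3 := \row_i nth 0 [:: x; y; z] i.

Lemma vec3_eta (v : 'rV[L]_3) : v = vec3 (v 0 0) (v 0 1) (v 0 2%:R).
Proof.
apply/rowP => i; rewrite !mxE.
by case: i => [[|[|[|i]]] lt_i] //=; congr (v _ _); apply: val_inj.
Qed.

Lemma diag_quartic_at (v : 'rV[L]_3) :
  mpoly_at f v = a * v 0 0 ^+ 4 + b * v 0 1 ^+ 4 + c * v 0 2%:R ^+ 4.
Proof.
rewrite /mpoly_at /diag_quartic !mevalD !mevalZ !rmorphXn /= !mevalXU.
by [].
Qed.

Lemma diag_quartic_neq0 : a != 0 -> f != 0.
Proof.
apply: contra => /eqP f0; have := diag_quartic_at (vec3 1 0 0).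
rewrite /mpoly_at f0 meval0 !mxE /= expr1n expr0n /= !mulr0 mulr1 !addr0.
by move=> <-.
Qed.

Lemma diag_quartic_homog : f \is 4.-homog.
Proof.
have X4 (i : 'I_3) : ('X_i ^+ 4 : {mpoly L[3]}) \is 4.-homog.
  by rewrite -[4%N]/(1 * 4)%N; apply: dhomogMn; rewrite dhomogX /= mdeg1.
by rewrite /diag_quartic !rpredD ?rpredZ.
Qed.

Lemma mderiv_X4 (i j : 'I_3) :
  ('X_i ^+ 4 : {mpoly L[3]})^`M(j) = ((i == j)%:R * 4%:R) *: 'X_i ^+ 3.
Proof.
have dX : ('X_i : {mpoly L[3]})^`M(j) = (i == j)%:R%:MP.
  rewrite mderivX mnm1E; case: eqVneq => [->|_]; last by rewrite scale0r mpolyC0.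
  rewrite (_ : (U_(j) - U_(j) = 0)%MM) ?mpolyX0 ?scale1r //.
  by apply/mnmP => k; rewrite mnmBE mnm0E subnn.
by rewrite -mul_mpolyC rmorphM /= !exprS expr0 !mderivM mderivC dX; ring.
Qed.

Lemma diag_quartic_deriv_at (v : 'rV[L]_3) :
  [/\ mpoly_at f^`M(0) v = 4%:R * a * v 0 0 ^+ 3,
      mpoly_at f^`M(1) v = 4%:R * b * v 0 1 ^+ 3 &
      mpoly_at f^`M(2%:R) v = 4%:R * c * v 0 2%:R ^+ 3].
Proof.
rewrite /mpoly_at /diag_quartic !mderivD !mderivZ !mderiv_X4 !mevalD !mevalZ.
rewrite !rmorphXn /= !mevalXU /=.
by split; ring.
Qed.

Lemma diag_quartic_nonsingular (v : 'rV[L]_3) :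
  2%:R != 0 :> L -> a != 0 -> b != 0 -> c != 0 -> v != 0 -> ~~ singular_vec f v.
Proof.
move=> two_neq0 a_neq0 b_neq0 c_neq0; apply: contra => /andP[_ /forallP sing_v].
have four_neq0 : 4%:R != 0 :> L by rewrite (natrM _ 2 2) mulf_neq0.
have [d0 d1 d2] := diag_quartic_deriv_at v.
have cube0 (k x : L) : k != 0 -> 4%:R * k * x ^+ 3 == 0 -> x = 0.
  move=> k0; rewrite mulf_eq0 (mulf_eq0 4%:R) (negPf four_neq0) (negPf k0) /=.
  by rewrite expf_eq0 => /eqP.
have v0 : v 0 0 = 0 by apply: (cube0 _ _ a_neq0); rewrite -d0 sing_v.
have v1 : v 0 1 = 0 by apply: (cube0 _ _ b_neq0); rewrite -d1 sing_v.
have v2 : v 0 2%:R = 0 by apply: (cube0 _ _ c_neq0); rewrite -d2 sing_v.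
rewrite [v]vec3_eta v0 v1 v2; apply/eqP/rowP => i; rewrite !mxE.
by case: i => [[|[|[|i]]] lt_i].
Qed.

(** The expansion of a polynomial in powers of X_0; keeping the coefficients in the
    ring of polynomials in three variables makes evaluation at X_0 a left
    inverse. *)
Definition poly_in_X0 : {mpoly L[3]} -> {poly {mpoly L[3]}} :=
  mmap (polyC \o @mpolyC 3 L) (fun i => if i == 0 then 'X else ('X_i)%:P).

Lemma poly_in_X0M : {morph poly_in_X0 : g h / g * h}.
Proof. exact: (mmap_is_multiplicative _ _).1. Qed.

Lemma poly_in_X0D : {morph poly_in_X0 : g h / g + h}.
Proof. exact: mmapD. Qed.

Lemma poly_in_X0_term (k : L) (m : 'X_{1..3}) :
  poly_in_X0 (k *: 'X_[m]) =
  (k%:MP)%:P * \prod_i (if i == 0 then 'X else ('X_i)%:P) ^+ m i.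
Proof. by rewrite /poly_in_X0 mmapZ mmapX. Qed.

Lemma poly_in_X00 : poly_in_X0 0 = 0.
Proof. exact: mmap0. Qed.

(* Unification would otherwise try to compute expansions. *)
Local Opaque poly_in_X0.

Lemma poly_in_X0K (g : {mpoly L[3]}) : (poly_in_X0 g).['X_0] = g.
Proof.
elim/mpolyind: g => [|k m g _ _ IHg]; first by rewrite poly_in_X00 horner0.
rewrite poly_in_X0D hornerD; congr (_ + _); last exact: IHg.
rewrite poly_in_X0_term hornerM hornerC mul_mpolyC; congr (_ *: _).
rewrite horner_prod [RHS]mpolyXE_id; apply: eq_bigr => i _.
by rewrite horner_exp; case: eqP => [->|_]; rewrite ?hornerX ?hornerC.
Qed.

Lemma poly_in_X0_at (v : 'I_3 -> L) (t : L) (g : {mpoly L[3]}) :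
  (map_poly (meval v) (poly_in_X0 g)).[t] = g.@[fun i => if i == 0 then t else v i].
Proof.
elim/mpolyind: g => [|k m g _ _ IHg].
  by rewrite poly_in_X00 map_poly0 horner0 meval0.
rewrite poly_in_X0D rmorphD hornerD mevalD; congr (_ + _); last exact: IHg.
rewrite poly_in_X0_term rmorphM hornerM /= map_polyC hornerC /= mevalC mevalZ mevalX.
congr (_ * _).
rewrite rmorph_prod horner_prod; apply: eq_bigr => i _.
rewrite rmorphXn horner_exp /=; case: eqP => _; first by rewrite map_polyX hornerX.
by rewrite map_polyC /= mevalXU hornerC.
Qed.

Lemma poly_in_X0_diag_quartic :
  poly_in_X0 f = a%:MP *: 'X^4 + (b *: 'X_1 ^+ 4 + c *: 'X_2%:R ^+ 4)%:P.
Proof.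
have term (k : L) i : poly_in_X0 (k *: 'X_i ^+ 4) =
    (k%:MP)%:P * (if i == 0 then 'X else ('X_i)%:P) ^+ 4.
  rewrite mpolyXn poly_in_X0_term; congr (_ * _).
  rewrite (bigD1 i) //= mulmnE mnm1E eqxx big1 ?mulr1 // => j ne_ji.
  by rewrite mulmnE mnm1E [i == j]eq_sym (negPf ne_ji).
rewrite /diag_quartic 2!poly_in_X0D (term a) (term b) (term c) /= -addrA.
congr (_ + _); first by rewrite mul_polyC.
have polyCX4 (k : L) (i : 'I_3) :
    (k%:MP)%:P * ('X_i)%:P ^+ 4 = (k *: 'X_i ^+ 4)%:P :> {poly {mpoly L[3]}}.
  by rewrite -mul_mpolyC -polyC_exp -polyCM.
by rewrite !polyCX4 -polyCD.
Qed.

Lemma mpoly_unit_const (n : nat) (g : {mpoly L[n]}) :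
  (g \is a GRing.unit) -> exists2 k : L, k != 0 & g = k%:MP.
Proof.
case/andP=> /eqP gE; rewrite unitfE => g0; by exists g@_0.
Qed.

Lemma mpolyC_unit (n : nat) (k : L) : k != 0 -> (k%:MP : {mpoly L[n]}) \is a GRing.unit.
Proof. by move=> k0; apply: (@rmorph_unit _ _ (@mpolyC n L)); rewrite unitfE. Qed.

Lemma poly_dvd_Xn (F : fieldType) (k : F) (P Q : {poly F}) n :
  k != 0 -> P * Q = k *: 'X^n -> P.[0] != 0 -> size P = 1%N.
Proof.
move=> k0 PQ P0.
have cPX : coprimep P 'X^n.
  apply: coprimep_expr; rewrite -['X]subr0 -polyC0.
  by rewrite coprimep_XsubC.
have dvP : P %| 'X^n by rewrite -(dvdpZr _ _ k0) -PQ dvdp_mulr.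
by have := coprimep_dvdl dvP cPX; rewrite coprimepp => /eqP.
Qed.

Lemma singular_mul (v : 'rV[L]_3) (g h : {mpoly L[3]}) :
  mpoly_at g v = 0 -> mpoly_at h v = 0 -> singular_vec (g * h) v.
Proof.
rewrite /mpoly_at => g0 h0; apply/andP; split.
  by rewrite /mpoly_at mevalM g0 mul0r.
by apply/forallP => i; rewrite /mpoly_at mderivM mevalD !mevalM g0 h0 mul0r mulr0 addr0.
Qed.

End Geometry.

Local Opaque poly_in_X0.

(** Restrict f = g h to the affine line of the points (t, z, 1), where
    b z^4 + c = 0: there g and h become divisors of a t^4.  Their leading
    coefficients in X_0 are constants, since the product of these is a; so a
    factor whose restriction does not vanish at 0 has degree 0 in X_0 and is a
    constant.  If both restrictions vanish at 0, the point (0, z, 1) is a common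
    zero of g and h, hence a singular point of the curve. *)
Lemma diag_quartic_irreducible (L : closedFieldType) (a b c : L) :
  2%:R != 0 :> L -> a != 0 -> b != 0 -> c != 0 ->
  irreducible_mpoly (diag_quartic a b c).
Proof.
move=> two_neq0 a_neq0 b_neq0 c_neq0.
split; first exact: diag_quartic_neq0 a_neq0.
  apply/negP => /mpoly_unit_const[k k0 fE].
  have := diag_quartic_homog L a b c; rewrite fE => hom.
  have hom0 : (k%:MP : {mpoly L[3]}) \is 0.-homog.
    by rewrite -[k]mulr1 mpolyCM mul_mpolyC rpredZ // dhomog1.
  have k_neq0 : (k%:MP : {mpoly L[3]}) != 0 by rewrite mpolyC_eq0.
  by have := dhomog_uniq k_neq0 hom hom0.
move=> g h fE.
have [z bzc] : exists z : L, b * z ^+ 4 + c = 0.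
  have [z zE] := @solve_monicpoly L 4 (nth 0 [:: - (c / b)]) isT.
  exists z; rewrite zE !big_ord_recl big_ord0 /= !mul0r !addr0 expr0 mulr1.
  by rewrite mulrN mulrC divfK // addNr.
pose v : 'I_3 -> L := fun i => nth 0 [:: 0; z; 1] i.
pose phi g := map_poly (meval v) (poly_in_X0 L g).
have phif : phi g * phi h = a *: 'X^4.
  rewrite /phi -rmorphM -poly_in_X0M -fE poly_in_X0_diag_quartic rmorphD /= map_polyC /=.
  rewrite mevalD !mevalZ !rmorphXn /= !mevalXU /v /= expr1n mulr1 bzc addr0.
  by rewrite -mul_polyC rmorphM /= map_polyC /= mevalC map_polyXn mul_polyC.
have lcM : lead_coef (poly_in_X0 L g) * lead_coef (poly_in_X0 L h) = a%:MP.
  rewrite -lead_coefM -poly_in_X0M -fE poly_in_X0_diag_quartic lead_coefDl.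
    by rewrite lead_coefZ lead_coefXn mulr1.
  rewrite size_scale ?mpolyC_eq0 // size_polyXn.
  exact: leq_ltn_trans (size_polyC_leq1 _) _.
have /andP[ug uh] : (lead_coef (poly_in_X0 L g) \is a GRing.unit) &&
       (lead_coef (poly_in_X0 L h) \is a GRing.unit).
  by rewrite -unitrM lcM mpolyC_unit.
have unit_of (e : {mpoly L[3]}) : lead_coef (poly_in_X0 L e) \is a GRing.unit ->
    size (phi e) = 1%N -> e \is a GRing.unit.
  move=> ue; have [k0 k0_neq0 lcE] := mpoly_unit_const _ _ _ ue.
  rewrite /phi size_map_poly_id0 ?lcE ?mevalC //.
  move=> /eqP/size_poly1P[k _ eE].
  by rewrite -[e]poly_in_X0K eE hornerC; rewrite eE lead_coefC in ue.
have phi0 (e : {mpoly L[3]}) : (phi e).[0] = mpoly_at e (vec3 L 0 z 1).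
  rewrite poly_in_X0_at; apply: meval_eq => i; rewrite mxE /v.
  by case: i => [[|[|[|i]]] lt_i].
have [g0|g0] := eqVneq (phi g).[0] 0; last first.
  by left; apply: unit_of ug _; apply: poly_dvd_Xn a_neq0 phif g0.
have [h0|h0] := eqVneq (phi h).[0] 0; last first.
  by right; apply: unit_of uh _; rewrite mulrC in phif; apply: poly_dvd_Xn a_neq0 phif h0.
have v_neq0 : vec3 L 0 z 1 != 0.
  by apply/eqP => /rowP/(_ 2%:R)/eqP; rewrite !mxE /= oner_eq0.
have := diag_quartic_nonsingular L _ _ _ _ two_neq0 a_neq0 b_neq0 c_neq0 v_neq0.
rewrite fE => /negP[].
have gv : mpoly_at g (vec3 L 0 z 1) = 0 by exact: etrans (esym (phi0 g)) g0.
have hv : mpoly_at h (vec3 L 0 z 1) = 0 by exact: etrans (esym (phi0 h)) h0.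
exact: singular_mul L _ _ _ gv hv.
Qed.

(** * Hilbert function and genus *)

Section Hilbert.

Variables (K : fieldType) (f : {mpoly K[3]}) (d e : nat).
Hypotheses (f_neq0 : f != 0) (f_homog : f \is d.-homog).

Definition mul_form (h : dhomog 3 K e) : dhomog 3 K (d + e) :=
  DHomog (dhomogM f_homog (dhomog_is_dhomog h)).

Lemma mul_form_linear : linear mul_form.
Proof.
by move=> k g h; apply: val_inj; rewrite /= mulrDr -scalerAr.
Qed.

HB.instance Definition _ :=
  GRing.isLinear.Build K (dhomog 3 K e) (dhomog 3 K (d + e)) _ mul_form mul_form_linear.

Lemma mul_form_inj : injective mul_form.
Proof.
move=> g h /(congr1 val) /= /(mulfI f_neq0) gh; exact: val_inj.
Qed.

(** A generator f X^u whose degree is not d + e is projected to 0; the others are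
    the images of the monomials of degree e. *)
Lemma ideal_partE : ideal_part f (d + e) = limg (linfun mul_form).
Proof.
apply/eqP; rewrite eqEsubv; apply/andP; split.
  apply/span_subvP => _ /imageP[u _ ->].
  have [deg_u|deg_u] := eqVneq (mdeg u) e.
    have u_homog : ('X_[u] : {mpoly K[3]}) \is e.-homog by rewrite dhomogX; apply/eqP.
    have -> : indhomog (d + e) (f * 'X_[u]) = linfun mul_form (DHomog u_homog).
      rewrite lfunE /=; apply: val_inj; rewrite /indhomog val_insubd /=.
      by rewrite (dhomogM f_homog u_homog).
    exact: memv_img (memvf _).
  have -> : indhomog (d + e) (f * 'X_[u]) = 0; last exact: mem0v.
  rewrite /indhomog /insubd insubF //; apply/negP => fu_homog.
  have fu'_homog : f * 'X_[u] \is (d + mdeg u).-homog.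
    by apply: dhomogM => //; rewrite dhomogX.
  have fu_neq0 : f * 'X_[u] != 0.
    rewrite mulf_neq0 //; apply/eqP => /(congr1 (mcoeff u)); rewrite mcoeffX eqxx mcoeff0.
    by move/eqP; rewrite oner_eq0.
  have /addnI/eqP := dhomog_uniq fu_neq0 fu'_homog fu_homog.
  by rewrite (negPf deg_u).
apply/subvP => _ /memv_imgP[h _ ->]; rewrite lfunE /=.
have -> : mul_form h =
    \sum_(m <- msupp (val h)) (val h)@_m *: indhomog (d + e) (f * 'X_[m]).
  apply: val_inj; rewrite raddf_sum /= {1}[val h]mpolyE mulr_sumr.
  rewrite big_seq [RHS]big_seq; apply: eq_bigr => m /(dhomog_mf (dhomog_is_dhomog h)) /= deg_m.
  rewrite /indhomog val_insubd dhomogM ?dhomogX //= ?deg_m //.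
  by rewrite scalerAr.
rewrite big_seq; apply: memv_suml => m /(dhomog_mf (dhomog_is_dhomog h)) /= deg_m.
apply/memvZ/memv_span/imageP.
have lt_m : (mdeg m < (d + e).+1)%N by rewrite deg_m ltnS leq_addl.
by exists (BMultinom lt_m).
Qed.

Lemma dim_ideal_part : \dim (ideal_part f (d + e)) = 'C(e + 2, e).
Proof.
rewrite ideal_partE limg_dim_eq; first by rewrite dimvf.
apply/eqP; rewrite capfv; apply/lker0P => g h; rewrite !lfunE => /=; exact: mul_form_inj.
Qed.

Lemma hilbert_fun_form :
  hilbert_fun f (d + e) = ('C(d + e + 2, d + e) - 'C(e + 2, e))%N.
Proof. by rewrite /hilbert_fun dim_ideal_part dimvf. Qed.

End Hilbert.

Section Smooth.

Lemma map_diag_quartic (F E : fieldType) (phi : {rmorphism F -> E}) (a b c : F) :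
  map_mpoly phi (diag_quartic a b c) = diag_quartic (phi a) (phi b) (phi c).
Proof.
have map_term (k : F) i :
    map_mpoly phi (k *: 'X_i ^+ 4) = phi k *: ('X_i ^+ 4 : {mpoly E[3]}).
  by rewrite map_mpolyZ !mpolyXn map_mpolyX.
by rewrite /diag_quartic raddfD /= raddfD /= !map_term.
Qed.

Lemma poly_eq_on_nat (P Q : {poly rat}) m0 :
  (forall m, (m0 <= m)%N -> P.[m%:R] = Q.[m%:R]) -> P = Q.
Proof.
move=> eqPQ; apply/eqP; rewrite -subr_eq0; apply/negPn/negP => PQ_neq0.
pose rs := [seq m%:R : rat | m <- iota m0 (size (P - Q))].
have rs_roots : all (root (P - Q)) rs.
  apply/allP => _ /mapP[m + ->]; rewrite mem_iota => /andP[le_m _].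
  by rewrite /root !hornerE eqPQ ?subrr.
have rs_uniq : uniq rs.
  by rewrite map_inj_uniq ?iota_uniq // => m n /eqP; rewrite eqr_nat => /eqP.
by have := max_poly_roots PQ_neq0 rs_roots rs_uniq; rewrite size_map size_iota ltnn.
Qed.

(** A Hilbert polynomial is determined by its values at large integers, hence the
    genus is unique; this is what excludes extremality for another genus. *)
Lemma has_genus_inj (K : fieldType) (f : {mpoly K[3]}) g g' :
  has_genus f g -> has_genus f g' -> g = g'.
Proof.
move=> [P [m hP] P0] [Q [m' hQ] Q0].
have eqPQ : P = Q.
  apply: (@poly_eq_on_nat _ _ (maxn m m')) => k; rewrite geq_max => /andP[le_m le_m'].
  by rewrite hP ?hQ.
move: Q0; rewrite -eqPQ P0 => /addrI/oppr_inj/eqP.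
by rewrite eqr_nat => /eqP.
Qed.

Lemma bin2_add4 n : 'C(n + 4, 2) = ('C(n, 2) + (4 * n + 6))%N.
Proof. by rewrite !addnS addn0 !binS !bin1 !bin0; lia. Qed.

Lemma smooth_diag_quartic (K : fieldType) (a b c : K) :
  2%:R != 0 :> K -> a != 0 -> b != 0 -> c != 0 ->
  smooth_curve_of_genus (diag_quartic a b c) 3.
Proof.
move=> two_neq0 a_neq0 b_neq0 c_neq0; split.
- by exists 4%N; apply: diag_quartic_homog.
- move=> L phi; rewrite map_diag_quartic.
  by apply: diag_quartic_irreducible; rewrite ?fmorph_eq0 // -(rmorph_nat phi) fmorph_eq0.
- move=> L phi v; rewrite map_diag_quartic.
  by apply: diag_quartic_nonsingular; rewrite ?fmorph_eq0 // -(rmorph_nat phi) fmorph_eq0.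
exists (4%:R *: 'X - 2%:R%:P); last by rewrite !hornerE.
exists 4%N => m le4m; rewrite -(subnKC le4m); set e := (m - 4)%N.
rewrite hilbert_fun_form ?diag_quartic_homog ?diag_quartic_neq0 //.
rewrite -(bin_sub (leq_addr _ _)) addKn -(bin_sub (leq_addr 2 e)) addKn.
have -> : (4 + e + 2 = e + 2 + 4)%N by lia.
rewrite bin2_add4 addKn !hornerE /=; apply/eqP.
have -> : (4 * (e + 2) + 6)%N = (4 * (4 + e) - 2)%N by lia.
by rewrite natrB ?natrM //; lia.
Qed.
End Smooth.

(** * Counting projective points *)

Section ProjectiveCount.

Variables (K : finFieldType) (a b c : K).
Hypothesis a_neq0 : a != 0.
Local Notation f := (diag_quartic a b c).

Lemma proj_point_scale (k : K) (v : 'rV[K]_3) :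
  k != 0 -> proj_point (k *: v) = proj_point v.
Proof.
move=> k0; apply/setP => w; apply/imsetP/imsetP => -[l]; rewrite inE => l0 ->.
  by exists (l * k); rewrite ?inE ?mulf_neq0 // scalerA.
by exists (l / k); rewrite ?inE ?mulf_neq0 ?invr_eq0 // scalerA divfK.
Qed.

Lemma diag_quartic_scale (k : K) (v : 'rV[K]_3) :
  k != 0 -> (mpoly_at f (k *: v) == 0) = (mpoly_at f v == 0).
Proof.
move=> k0; rewrite !diag_quartic_at !mxE.
rewrite (_ : _ + _ = k ^+ 4 * (a * v 0 0 ^+ 4 + b * v 0 1 ^+ 4 + c * v 0 2%:R ^+ 4)).
  by rewrite mulf_eq0 expf_eq0 (negPf k0) andbF.
by ring.
Qed.

(** Normalized coordinates (x : y : 1) and (x : 1 : 0).  They miss the point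
    (1 : 0 : 0), which does not lie on the curve. *)
Definition affine_rep (u : K * K + K) : 'rV[K]_3 :=
  match u with inl p => vec3 K p.1 p.2 1 | inr x => vec3 K x 1 0 end.

Lemma affine_rep_neq0 u : affine_rep u != 0.
Proof.
case: u => [p|x]; apply/eqP => /rowP.
  by move/(_ 2%:R)/eqP; rewrite !mxE /= oner_eq0.
by move/(_ 1)/eqP; rewrite !mxE /= oner_eq0.
Qed.

Lemma mem_proj_point (v : 'rV[K]_3) : v \in proj_point v.
Proof. by apply/imsetP; exists 1; rewrite ?inE ?oner_eq0 ?scale1r. Qed.

Lemma affine_rep_inj : injective (fun u => proj_point (affine_rep u)).
Proof.
move=> u w /= uw; have := mem_proj_point (affine_rep u).
rewrite uw => /imsetP[k _].
case: u {uw} => [[x y]|x]; case: w => [[z t]|z] /= /rowP e.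
- have := e 2%:R; rewrite !mxE /= mulr1 => k1.
  have := e 0; have := e 1; rewrite !mxE /= -k1 !mul1r => -> ->; by [].
- by have /eqP := e 2%:R; rewrite !mxE /= mulr0 oner_eq0.
- have := e 2%:R; rewrite !mxE /= mulr1 => k0.
  by have /eqP := e 1; rewrite !mxE /= -k0 mul0r oner_eq0.
- have := e 1; rewrite !mxE /= mulr1 => k1.
  have := e 0; rewrite !mxE /= -k1 mul1r => -> //.
Qed.

Lemma card_rational_points :
  #|rational_points f|%:R =
  \sum_(x : K) \sum_(y : K) (a * x ^+ 4 + b * y ^+ 4 + c == 0)%:R +
  \sum_(x : K) (a * x ^+ 4 + b == 0)%:R :> int.
Proof.
pose zero u := mpoly_at f (affine_rep u) == 0.
have -> : rational_points f = [set proj_point (affine_rep u) | u in zero].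
  apply/setP => P; apply/imsetP/imsetP => -[v]; last first.
    move=> zero_v ->; exists (affine_rep v) => //.
    by rewrite inE affine_rep_neq0; apply: zero_v.
  rewrite inE => /andP[v_neq0 v_zero] ->.
  have [v2|v2] := eqVneq (v 0 2%:R) 0; last first.
    have repE : v = v 0 2%:R *: affine_rep (inl (v 0 0 / v 0 2%:R, v 0 1 / v 0 2%:R)).
      rewrite {1}[v]vec3_eta; apply/rowP => i; rewrite !mxE.
      by case: i => [[|[|[|i]]] lt_i] //=; rewrite ?mulr1 // mulrC divfK.
    exists (inl (v 0 0 / v 0 2%:R, v 0 1 / v 0 2%:R)).
      by rewrite -topredE /= /zero -(diag_quartic_scale _ _ v2) -repE.
    by rewrite {1}repE proj_point_scale.
  have [v1|v1] := eqVneq (v 0 1) 0; last first.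
    have repE : v = v 0 1 *: affine_rep (inr (v 0 0 / v 0 1)).
      rewrite {1}[v]vec3_eta v2; apply/rowP => i; rewrite !mxE.
      by case: i => [[|[|[|i]]] lt_i] //=; rewrite ?mulr1 ?mulr0 // mulrC divfK.
    exists (inr (v 0 0 / v 0 1)).
      by rewrite -topredE /= /zero -(diag_quartic_scale _ _ v1) -repE.
    by rewrite {1}repE proj_point_scale.
  move: v_zero; rewrite diag_quartic_at v1 v2 expr0n !mulr0 !addr0.
  rewrite mulf_eq0 (negPf a_neq0) expf_eq0 /= => /eqP v0.
  case/eqP: v_neq0; rewrite [v]vec3_eta v0 v1 v2; apply/rowP => i; rewrite !mxE.
  by case: i => [[|[|[|i]]] lt_i].
rewrite (card_imset _ affine_rep_inj) -sum1_card natr_sum.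
transitivity (\sum_u (zero u)%:R : int).
  by rewrite big_mkcond; apply: eq_bigr => u _; rewrite -topredE /=; case: (zero u).
rewrite big_sumType /=; congr (_ + _).
  rewrite pair_big /=; apply: eq_bigr => p _.
  by rewrite /zero diag_quartic_at !mxE /= expr1n mulr1.
apply: eq_bigr => x _.
by rewrite /zero diag_quartic_at !mxE /= expr1n expr0n /= mulr1 mulr0 addr0.
Qed.
End ProjectiveCount.

(** The affine part z = 1 is the quartic of [card_quartic] with d = i gamma / alpha
    and e = i gamma / beta, because -1 = i^2.  The points at infinity are the
    fourth roots of (i beta / alpha)^2, counted by [sum_root4]. *)
Lemma card_points_squares (K : finFieldType) (zeta al be ga : K) :
  2%:R != 0 :> K -> zeta ^+ 4 = -1 -> al != 0 -> be != 0 -> ga != 0 ->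
  #|rational_points (diag_quartic (al ^+ 2) (be ^+ 2) (ga ^+ 2))|%:R =
  (#|K|%:R : int) + 1 +
  (qchar K (al * ga) + qchar K (be * ga) + qchar K (al * be)) * jacobsthal K 1.
Proof.
move=> two_neq0 zeta4 al0 be0 ga0.
have [i [i2 i0 qchari]] : exists i, [/\ i ^+ 2 = -1, i != 0 & qchar K i = 1].
  exists (zeta ^+ 2); split; first exact: im_sqr.
    by rewrite expf_neq0 // (zeta_neq0 K zeta zeta4).
  exact: qchar_im.
rewrite card_rational_points ?expf_neq0 //.
have d0 : i * ga / al != 0 by rewrite !mulf_neq0 ?invr_eq0.
have e0 : i * ga / be != 0 by rewrite !mulf_neq0 ?invr_eq0.
have -> : \sum_(x : K) \sum_(y : K)
      (al ^+ 2 * x ^+ 4 + be ^+ 2 * y ^+ 4 + ga ^+ 2 == 0)%:R =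
    \sum_(x : K) \sum_(y : K)
      ((x ^+ 2 / (i * ga / al)) ^+ 2 + (y ^+ 2 / (i * ga / be)) ^+ 2 == 1)%:R :> int.
  apply: eq_bigr => x _; apply: eq_bigr => y _.
  have -> : (x ^+ 2 / (i * ga / al)) ^+ 2 + (y ^+ 2 / (i * ga / be)) ^+ 2 =
     - (al ^+ 2 * x ^+ 4 + be ^+ 2 * y ^+ 4) / ga ^+ 2.
    rewrite !expr_div_n [(i * ga) ^+ 2]exprMn i2; field.
    by rewrite ga0 be0 oppr_eq0 oner_eq0 al0.
  rewrite -[RHS]/((_ == _)%:R); congr (nat_of_bool _)%:R.
  apply/eqP/eqP => [e|e].
    rewrite (_ : al ^+ 2 * x ^+ 4 + be ^+ 2 * y ^+ 4 = - ga ^+ 2).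
      by rewrite opprK mulfV // expf_neq0.
    by apply/eqP; rewrite -addr_eq0 e.
  have -> : ga ^+ 2 = - (al ^+ 2 * x ^+ 4 + be ^+ 2 * y ^+ 4) / ga ^+ 2 * ga ^+ 2.
    by rewrite e mul1r.
  by rewrite divfK ?expf_neq0 // addrN.
rewrite (card_quartic K two_neq0 zeta zeta4 _ _ d0 e0).
have -> : \sum_(x : K) (al ^+ 2 * x ^+ 4 + be ^+ 2 == 0)%:R =
    2%:R * (1 + qchar K (al * be)) :> int.
  have u0 : (i * be / al) ^+ 2 != 0 by rewrite expf_neq0 // !mulf_neq0 ?invr_eq0.
  have -> : qchar K (al * be) = qchar K (i * be / al).
    by rewrite !qcharM // qcharV // qchari; ring.
  rewrite -(sum_root4 K two_neq0 zeta zeta4 _ _ u0 erefl) [RHS]big_mkcond /=.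
  apply: eq_bigr => x _.
  have -> : (al ^+ 2 * x ^+ 4 + be ^+ 2 == 0) = (x ^+ 4 == (i * be / al) ^+ 2).
    rewrite expr_div_n [(i * be) ^+ 2]exprMn i2 addr_eq0 mulN1r mulrC.
    by apply/eqP/eqP => [<-|->]; rewrite ?mulfK ?divfK ?expf_neq0.
  by case: eqP.
rewrite !qcharM // !qcharV // qchari.
by case: (qchar_pm1 K ga ga0) => ->; ring.
Qed.

(** * Maximal and minimal quartics *)

Theorem theorem7p3 (p : nat) (p_prime : prime p) (p_odd : odd p)
  (a b c : 'F_p) (a_neq0 : a != 0) (b_neq0 : b != 0) (c_neq0 : c != 0)
  (n : nat) (n_gt0 : (0 < n)%N)
  (K : finFieldType) (cardK : #|K| = (p ^ (2 * n))%N)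
  (iota : {rmorphism 'F_p -> K}) :
  let C := map_mpoly iota (diag_quartic a b c) in
  [/\ smooth_curve_of_genus C 3,
      maximal_curve C <-> (4 %| p ^ n + 1)%N &
      minimal_curve C <-> (4 %| p ^ n - 1)%N /\ p = 3 %[mod 4]].
Proof.
move=> C; have -> : C = diag_quartic (iota a) (iota b) (iota c).
  exact: map_diag_quartic.
have p_gt2 : (2 < p)%N by apply: odd_prime_gt2.
have p_ge5 : (p %% 4 = 1)%N -> (4 < p)%N.
  by move=> p1; case: p p1 p_gt2 {p_prime p_odd a b c a_neq0 b_neq0 c_neq0 cardK iota C}
    => [|[|[|[|[|p]]]]].
have chK : p \in [pchar K].
  by rewrite (fmorph_pchar iota) pchar_Fp.
have two_neq0 : 2%:R != 0 :> K by rewrite -(dvdn_pcharf chK) gtnNdvd.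
have p_mod4 : (p %% 4 = 1 \/ p %% 4 = 3)%N by move: p_odd; clear; lia.
(* All the roots extracted below exist because p^2 - 1 divides q - 1. *)
have [t qE] : exists t, (#|K|.-1 = (p.-1 * p.+1) * t)%N.
  rewrite cardK expnM predn_exp.
  exists (\sum_(i < n) (p ^ 2) ^ i)%N; congr (_ * _)%N.
  by move: p_gt2; case: (p) => // k _; nia.
have q8 : (8 %| #|K|.-1)%N.
  rewrite qE dvdn_mulr //; apply/dvdnP.
  have [k kE] : exists k, p = k.*2.+1 by exists p./2; rewrite -[LHS]odd_double_half p_odd.
  have [l lE] : exists l, (k * k.+1 = l.*2)%N.
    by exists (k * k.+1)./2; rewrite even_halfK // oddM /= andbN.
  by exists l; rewrite kE /=; move: lE; clear; lia.
have [m mE] : exists m, (#|K|.-1./2 = m.*2)%N.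
  by case/dvdnP: q8 => k ->; exists (2 * k)%N; move: k; clear; lia.
have q4 : (4 %| #|K|.-1)%N by apply: dvdn_trans q8.
have [zeta zeta4] : exists zeta : K, zeta ^+ 4 = -1.
  have N1 : -1 != 0 :> K by rewrite oppr_eq0 oner_eq0.
  have [|z zE] := power_residue K 4 (-1) q4 N1; last by exists z.
  case/dvdnP: q8 => k ->; have -> : (k * 8 %/ 4 = 2 * k)%N by clear; lia.
  by rewrite exprM sqrrN !expr1n.
have iota_pow k (x : 'F_p) : x != 0 -> (p.-1 %| k)%N -> iota x ^+ k = 1.
  move=> x0 /dvdnP[j ->]; rewrite mulnC exprM -rmorphXn /=.
  by have := expf_card_pred _ x x0; rewrite card_Fp // => ->; rewrite rmorph1 expr1n.
have iota_sqrt (x : 'F_p) : x != 0 -> exists2 y : K, y != 0 & iota x = y ^+ 2.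
  move=> x0; have ix0 : iota x != 0 by rewrite fmorph_eq0.
  have [||y yE] := power_residue K 2 (iota x) _ ix0.
  - exact: dvdn_trans q8.
  - apply: iota_pow => //; rewrite qE; apply/dvdnP; exists (p.+1./2 * t)%N.
    have -> : (p.-1 * p.+1 * t = (p.+1./2 * t * p.-1) * 2)%N.
      have : p.+1 = p.+1./2.*2 by rewrite even_halfK //= p_odd.
      by move: (p.+1./2) => k ->; rewrite -muln2; ring.
    by rewrite mulnK.
  by exists y => //; apply: contra_neq ix0 => y0; rewrite yE y0 expr0n.
have [al al0 alE] := iota_sqrt a a_neq0.
have [be be0 beE] := iota_sqrt b b_neq0.
have [ga ga0 gaE] := iota_sqrt c c_neq0.
have smooth : smooth_curve_of_genus (diag_quartic (iota a) (iota b) (iota c)) 3.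
  by apply: smooth_diag_quartic; rewrite ?fmorph_eq0.
have := card_points_squares K zeta al be ga two_neq0 zeta4 al0 be0 ga0.
rewrite -alE -beE -gaE.
have qK : #|K|%:R = (p ^ n)%:R ^+ 2 :> int by rewrite cardK mulnC expnM natrX.
have sqrt_card Q : #|K| = (Q ^ 2)%N -> Q = (p ^ n)%N.
  by rewrite cardK mulnC expnM => /eqP; rewrite eqn_exp2r // => /eqP.
have pn_mod4 : (p %% 4 = 1)%N -> (p ^ n %% 4 = 1)%N.
  by move=> p1; rewrite -modnXm p1 exp1n.
have pn_gt0 : (0 < p ^ n)%N by rewrite expn_gt0 prime_gt0.
move: smooth; move: (diag_quartic _ _ _) => f smooth NE.
case: p_mod4 => p_mod4.
  (* Maximal and minimal curves of any genus have q + 1 + e p^n points, which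
     is 1 modulo p. *)
  have not_extremal (e : int) : #|rational_points f|%:R <> #|K|%:R + 1 + e * (p ^ n)%:R.
    rewrite NE => /addrI/(congr1 (fun z : int => z%:~R : K)); rewrite !intrM.
    rewrite (jacobsthal1_modp K two_neq0 m mE).
    have -> : ((p ^ n)%:R : int)%:~R = 0 :> K.
      by rewrite natz -pmulrn natrX (pcharf0 chK) expr0n (gtn_eqF n_gt0).
    move/eqP; rewrite mulr0 mulrN oppr_eq0 mulf_eq0 -(dvdn_pcharf chK) mE.
    have -> : (p %| 'C(m.*2, m))%N = false.
      apply: negPf; apply: (bin_central_ndvd p (2 * n)%N) => //; rewrite -cardK.
      have := card_odd K two_neq0; rewrite mE; move: #|K|; clear; lia.
    have three_neq0 : 3%:R != 0 :> K.
      by rewrite -(dvdn_pcharf chK) gtnNdvd // ltnW // p_ge5.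
    rewrite orbF !qcharM //.
    (* Two of the three square roots have the same character: the sum of the
       signs is 3 or -1. *)
    by case: (qchar_pm1 K al al0) => ->; case: (qchar_pm1 K be be0) => ->;
       case: (qchar_pm1 K ga ga0) => ->;
       rewrite -?[_ + _ + _]/(3 : int) -?[_ + _ + _]/(-1 : int)
         ?(negPf three_neq0) ?mulrN1z ?oppr_eq0 ?oner_eq0.
  split=> //.
    split=> [[Q [g [/sqrt_card-> _ NQ]]]|].
      by case: (not_extremal (2 * g)%:R); rewrite NQ qK; ring.
    have := pn_mod4 p_mod4; move: (p ^ n)%N; clear; lia.
  split=> [[Q [g [/sqrt_card-> _ NQ]]]|].
    by case: (not_extremal (- (2 * g)%:R)); rewrite natz NQ qK; ring.
  by rewrite p_mod4 => -[].
have NE3 : #|rational_points f|%:R = (p ^ n)%:R ^+ 2 + 1 +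
    (if (p ^ n %% 4 == 3)%N then 6 else - 6) * (p ^ n)%:R :> int.
  (* eta(y) = y^(2m) = x^m, and p - 1 divides m = (q - 1) / 4 as 4 divides
     p + 1. *)
  have qchar_root x (y : K) : x != 0 -> y != 0 -> iota x = y ^+ 2 -> qchar K y = 1.
    move=> x0 y0 xE; rewrite /qchar (negPf y0) mE -mul2n exprM -xE iota_pow ?eqxx //.
    apply/dvdnP; exists ((p %/ 4).+1 * t)%N.
    have : (m.*2.*2 = p.-1 * p.+1 * t)%N.
      by rewrite -qE; have := card_odd K two_neq0; rewrite mE => ->.
    have -> : p.+1 = (4 * (p %/ 4).+1)%N by move: p_mod4; clear; lia.
    by clear; nia.
  have al1 := qchar_root a al a_neq0 al0 alE.
  have be1 := qchar_root b be b_neq0 be0 beE.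
  have ga1 := qchar_root c ga c_neq0 ga0 gaE.
  rewrite NE !qcharM // al1 be1 ga1 qK.
  rewrite (jacobsthal1_inert K zeta p n two_neq0 zeta4 q8 p_prime p_mod4 cardK).
  by case: ifP => _; ring.
have pn_odd : (p ^ n %% 4 = 1 \/ p ^ n %% 4 = 3)%N.
  have : odd (p ^ n) by rewrite oddX p_odd orbT.
  by move: (p ^ n)%N; clear; lia.
have genus3 g : smooth_curve_of_genus f g -> g = 3.
  by move=> [_ _ _ hg]; case: smooth => _ _ _; apply: has_genus_inj hg.
split=> //.
  split=> [[Q [g [/sqrt_card-> /genus3-> NQ]]]|mod4].
    move: NE3 pn_odd pn_gt0; rewrite NQ; move: (p ^ n)%N; clear.
    by move=> Q; case: eqP => QE; nia.
  exists (p ^ n)%N, 3%N; split=> //; first by rewrite cardK mulnC expnM.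
  move: NE3 mod4; move: #|rational_points f| (p ^ n)%N; clear.
  by move=> N Q; case: eqP => QE; nia.
split=> [[Q [g [/sqrt_card-> /genus3-> NQ]]]|[mod4 _]].
  split; last by rewrite p_mod4.
  move: NE3 pn_odd pn_gt0; rewrite natz NQ; move: (p ^ n)%N; clear.
  by move=> Q; case: eqP => QE; nia.
exists (p ^ n)%N, 3%N; split=> //; first by rewrite cardK mulnC expnM.
move: NE3 mod4 pn_gt0; move: #|rational_points f| (p ^ n)%N; clear.
by move=> N Q; case: eqP => QE; nia.
Qed.
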